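(* Let $s\ge 2$ and let $H_1,\dots,H_s$ be pairwise vertex-disjoint connected finite simple graphs. Assume that for each $1\le i\le s$, $\mathrm{ind\text{-}match}(H_i)=1$ and $H_i$ satisfies one of: (a) there is a vertex $v_i\in V(H_i)$ having a neighbor $w\in V(H_i)$ with $\deg_{H_i}(w)=1$; or (b) $H_i$ is a complete bipartite graph, in which case $v_i\in V(H_i)$ is chosen arbitrarily. Let $v$ be a new vertex and let $G$ be the graph with $V(G)=\bigcup_{i=1}^s V(H_i)\cup\{v\}$ and $E(G)=\bigcup_{i=1}^s E(H_i)\cup\{\{v_i,v\}:1\le i\le s\}$. Then $\mathrm{ind\text{-}match}(G)=s$.
   Context: A matching is a set of pairwise disjoint edges; an induced matching is a matching $M$ such that for distinct $e,f\in M$ there is no edge $g$ of the graph meeting both $e$ and $f$. $\mathrm{ind\text{-}match}$ denotes the maximum size of an induced matching. *)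

(* Defs.v *)
From mathcomp Require Import all_boot.

Set Implicit Arguments.
Unset Strict Implicit.
Unset Printing Implicit Defensive.

(* The ambient type T lets several graphs live on different vertex sets, so
   that disjointness and unions of vertex sets are literal set operations. *)
Record sgraph (T : finType) := SGraph {
  vertices : {set T};
  edges : {set {set T}};
  edges_wf : [forall e in edges, (e \subset vertices) && (#|e| == 2)]
}.

Section Graphs.
Variable T : finType.
Implicit Types (G : sgraph T) (M : {set {set T}}) (e f g : {set T}).

(* Irreflexive, since [set x; x] has cardinality 1. *)
Definition adj G : rel T := fun x y => [set x; y] \in edges G.

Definition degree G (x : T) : nat := #|[set y | adj G x y]|.

Definition connected_graph G : Prop :=
  vertices G != set0 /\
  {in vertices G &, forall x y, connect (adj G) x y}.

Definition complete_bipartite G : Prop :=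
  exists A B : {set T},
    [/\ A :|: B = vertices G, [disjoint A & B]
      & edges G = [set [set a; b] | a in A, b in B]].

Definition meets e f : bool := e :&: f != set0.

Definition matching G M : bool :=
  (M \subset edges G) &&
  [forall e in M, forall f in M, (e != f) ==> [disjoint e & f]].

Definition induced_matching G M : bool :=
  matching G M &&
  [forall e in M, forall f in M, (e != f) ==>
     ~~ [exists g in edges G, meets g e && meets g f]].

Definition ind_match G : nat :=
  \max_(M : {set {set T}} | induced_matching G M) #|M|.

End Graphs.

(* Main.v *)
(** For the upper bound, label each edge of an induced matching [M] of [G] by
    the index [i] such that it lies in [H i] or equals [vs i, v]; this labelling
    is injective on [M]. Indeed two distinct edges of [H i] are met by a common
    edge because the induced matching number of [H i] is 1, and hypotheses
    (a), (b) each ensure that every edge of [H i] is met by an edge of [H i]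
    through [vs i]. For the lower bound, any choice of one edge in each [H i]
    is an induced matching of [G]. *)

Require Import Defs.
From mathcomp Require Import all_boot.

Section InducedMatching.
Set Implicit Arguments.
Unset Strict Implicit.
Variable T : finType.
Implicit Types (G : sgraph T) (M : {set {set T}}) (e f g : {set T}).

Lemma meetsP e f : reflect (exists2 x, x \in e & x \in f) (meets e f).
Proof.
apply: (iffP (set0Pn _)) => [[x]|[x xe xf]].
  by rewrite inE => /andP[xe xf]; exists x.
by exists x; rewrite inE xe.
Qed.

Lemma edge_subset G e : e \in edges G -> e \subset vertices G.
Proof. by move=> eG; have /forall_inP/(_ e eG)/andP[] := edges_wf G. Qed.

Lemma card_edge G e : e \in edges G -> #|e| = 2.
Proof. by move=> eG; have /forall_inP/(_ e eG)/andP[_ /eqP] := edges_wf G. Qed.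

Lemma edge_mem_adj G e x : e \in edges G -> x \in e ->
  exists2 y, e = [set x; y] & adj G x y.
Proof.
move=> eG xe; have /eqP/cards2P[a [b [_ eab]]] := card_edge eG.
move: xe; rewrite eab !inE => /orP[]/eqP->.
  by exists b; rewrite // /adj -eab.
by exists a; rewrite /adj 1?setUC // -eab.
Qed.

Lemma meets_refl G e : e \in edges G -> meets e e.
Proof. by move=> /card_edge e2; rewrite /meets setIid -card_gt0 e2. Qed.

(* Disjointness is redundant: an edge meeting a distinct edge [f] is itself an
   edge meeting both. *)
Lemma induced_matchingP G M :
  reflect (M \subset edges G /\
           {in M &, forall e f, e != f ->
              {in edges G, forall g, meets g e -> ~~ meets g f}})
          (induced_matching G M).
Proof.
apply: (iffP andP) => [[/andP[MG _] /forall_inP indM]|[MG indM]].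
  split=> // e f eM fM ef g gG ge.
  have /forall_inP/(_ f fM) := indM e eM.
  rewrite ef => /exists_inPn/(_ g gG).
  by rewrite ge.
split; first apply/andP; first split=> //.
  apply/forall_inP=> e eM; apply/forall_inP=> f fM; apply/implyP=> ef.
  have eG := subsetP MG e eM.
  by have := indM e f eM fM ef e eG (meets_refl eG); rewrite negbK setI_eq0.
apply/forall_inP=> e eM; apply/forall_inP=> f fM; apply/implyP=> ef.
apply/exists_inPn=> g gG; apply/negP=> /andP[ge].
by apply/negP; apply: indM ge.
Qed.

Lemma ind_match_geq G M : induced_matching G M -> #|M| <= ind_match G.
Proof. exact: (@leq_bigmax_cond _ _ (fun M => #|M|)). Qed.

Lemma ind_match1_edge G : ind_match G = 1 -> exists e, e \in edges G.
Proof.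
move=> G1; apply/set0Pn/eqP => E0.
suff: ind_match G <= 0 by rewrite G1.
apply/bigmax_leqP=> M /induced_matchingP[].
by rewrite E0 subset0 => /eqP->; rewrite cards0.
Qed.

(** If no edge met both, then for distinct [e] and [f] the pair [[set e; f]] would be an induced
    matching of size 2. For [e = f] the edge itself serves as [g]. *)
Lemma ind_match1_meets G e f : ind_match G = 1 ->
    e \in edges G -> f \in edges G ->
  exists2 g, g \in edges G & meets g e && meets g f.
Proof.
move=> G1 eG fG.
have [<-|ef] := eqVneq e f; first by exists e; rewrite // (meets_refl eG).
apply/exists_inP/contraT=> /exists_inPn no_g.
suff /ind_match_geq: induced_matching G [set e; f] by rewrite cards2 ef G1.
apply/induced_matchingP; split.
  by apply/subsetP=> x; rewrite !inE => /orP[]/eqP->.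
move=> x y; rewrite !inE => /orP[]/eqP-> /orP[]/eqP->; rewrite ?eqxx // => _ g gG.
  by move=> ge; have := no_g g gG; rewrite ge.
by move=> gf; have := no_g g gG; rewrite gf andbT.
Qed.

Lemma leaf_edge G x w g : adj G x w -> degree G w = 1 ->
  g \in edges G -> w \in g -> x \in g.
Proof.
move=> xw /eqP/cards1P[z Nw] gG wg.
have [y -> wy] := edge_mem_adj gG wg.
have: y \in [set y | adj G w y] by rewrite inE.
have: x \in [set y | adj G w y] by rewrite inE /adj setUC.
by rewrite Nw !inE => /eqP-> /eqP->; rewrite eqxx orbT.
Qed.

(** Some edge [g] meets both [f] and the edge from [x] to its leaf [w]. Either [g] contains [x]
    already, or it contains [w], and then it must contain the sole neighbor [x] of [w]. *)
Lemma leaf_neighbor_meets G x w f : ind_match G = 1 ->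
    adj G x w -> degree G w = 1 -> f \in edges G ->
  exists g, [/\ g \in edges G, x \in g & meets g f].
Proof.
move=> G1 xw w1 fG; have [g gG /andP[/meetsP[z zg zxw] gf]] := ind_match1_meets G1 xw fG.
exists g; split=> //; move: zxw zg; rewrite !inE => /orP[]/eqP-> //.
exact: leaf_edge xw w1 gG.
Qed.

(** An edge has an endpoint on each side, so [x] can be joined to the endpoint of [f] lying on the
    side opposite to [x]. *)
Lemma complete_bipartite_meets G x f : complete_bipartite G ->
    x \in vertices G -> f \in edges G ->
  exists g, [/\ g \in edges G, x \in g & meets g f].
Proof.
move=> [A [B [<- _ ->]]] xAB /imset2P[a b aA bB ->].
move: xAB; rewrite inE => /orP[xA|xB].
  exists [set x; b]; split; [exact: imset2_f | by rewrite !inE eqxx |].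
  by apply/meetsP; exists b; rewrite !inE eqxx orbT.
exists [set a; x]; split; [exact: imset2_f | by rewrite !inE eqxx orbT |].
by apply/meetsP; exists a; rewrite !inE eqxx.
Qed.

End InducedMatching.

Theorem theorem1p9 (T : finType) (s : nat) (H : 'I_s -> sgraph T)
    (vs : 'I_s -> T) (v : T) (G : sgraph T)
    (s_ge2 : 2 <= s)
    (H_disj : forall i j : 'I_s, i != j ->
       [disjoint vertices (H i) & vertices (H j)])
    (H_conn : forall i : 'I_s, connected_graph (H i))
    (H_ind : forall i : 'I_s, ind_match (H i) = 1)
    (vs_in : forall i : 'I_s, vs i \in vertices (H i))
    (H_ab : forall i : 'I_s,
       (exists w : T, [/\ w \in vertices (H i), adj (H i) (vs i) w
                        & degree (H i) w = 1])
       \/ complete_bipartite (H i))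
    (v_new : forall i : 'I_s, v \notin vertices (H i))
    (VG : vertices G = (\bigcup_(i < s) vertices (H i)) :|: [set v])
    (EG : edges G = (\bigcup_(i < s) edges (H i))
                    :|: [set [set vs i; v] | i : 'I_s]) :
  ind_match G = s.
Proof.
have HG i e : e \in edges (H i) -> e \in edges G.
  by move=> ei; rewrite EG inE; apply/orP; left; apply/bigcupP; exists i.
have vG i : [set vs i; v] \in edges G.
  by rewrite EG inE; apply/orP; right; apply: imset_f.
have H_block i j x : x \in vertices (H i) -> x \in vertices (H j) -> i = j.
  move=> xi xj; apply/eqP/contraT=> /H_disj/disjointFr/(_ xi).
  by rewrite xj.
have H_vs i f : f \in edges (H i) ->
    exists g, [/\ g \in edges (H i), vs i \in g & meets g f].
  move=> fi; have [[w [_ vw w1]]|bip] := H_ab i.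
    exact: leaf_neighbor_meets (H_ind i) vw w1 fi.
  exact: complete_bipartite_meets bip (vs_in i) fi.
apply/eqP; rewrite eqn_leq; apply/andP; split.
  apply/bigmax_leqP=> M /induced_matchingP[/subsetP MG indM].
  pose lab i e := (e \in edges (H i)) || (e == [set vs i; v]).
  have lab_ex e : e \in M -> exists i, lab i e.
    move=> /MG; rewrite EG inE => /orP[/bigcupP[i _ ei]|/imsetP[i _ ->]].
      by exists i; rewrite /lab ei.
    by exists i; rewrite /lab eqxx orbT.
  have no_pendant i f : [set vs i; v] \in M -> f \in M -> f \notin edges (H i).
    move=> vM fM; apply/negP=> fi.
    (* The new vertex [v] lies on the connecting edge but outside [H i], hence not on [f]. *)
    have vf : [set vs i; v] != f.
      apply: contra (v_new i) => /eqP vf; apply: (subsetP (edge_subset fi)).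
      by rewrite -vf !inE eqxx orbT.
    have [g [gi vg]] := H_vs i f fi.
    apply/negP; apply: (indM _ _ vM fM vf g (HG i g gi)).
    by apply/meetsP; exists (vs i); rewrite // !inE eqxx.
  (* Two distinct edges of [H i] would be met by a common edge of [H i], which is an edge of [G];
     the mixed cases contradict [no_pendant]. *)
  have lab_inj i e f : e \in M -> f \in M -> lab i e -> lab i f -> e = f.
    move=> eM fM /orP[ei|/eqP eE] /orP[fi|/eqP fE].
    - have [g gi /andP[ge gf]] := ind_match1_meets (H_ind i) ei fi.
      by apply/eqP/contraT=> ef; have := indM e f eM fM ef g (HG i g gi) ge; rewrite gf.
    - by rewrite fE in fM; have := no_pendant i e fM eM; rewrite ei.
    - by rewrite eE in eM; have := no_pendant i f eM fM; rewrite fi.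
    - by rewrite eE fE.
  (* The default is index 0, available since [0 < s]; by [lab_ex] it is never reached for an edge of
     [M]. *)
  pose ix e := odflt (Ordinal (ltnW s_ge2)) [pick i | lab i e].
  have ixP e : e \in M -> lab (ix e) e.
    by move=> /lab_ex[i ie]; rewrite /ix; case: pickP => [//|/(_ i)]; rewrite ie.
  rewrite -(@card_in_imset _ _ ix) => [|e f eM fM eq_ix].
    by rewrite -[X in _ <= X]card_ord max_card.
  by apply: (lab_inj (ix e)) => //; [exact: ixP | rewrite eq_ix; exact: ixP].
pose ed i := xchoose (ind_match1_edge (H_ind i)).
have edP i : ed i \in edges (H i) by exact: xchooseP.
have ed_block i x : x \in ed i -> x \in vertices (H i).
  exact/subsetP/edge_subset/edP.
have ed_inj : injective ed.
  move=> i j eq_ed; have /meetsP[x xi _] := meets_refl (edP i).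
  by apply: (H_block i j x); apply: ed_block; rewrite -?eq_ed.
rewrite -[X in X <= _]card_ord -(card_imset _ ed_inj); apply: ind_match_geq.
apply/induced_matchingP; split.
  by apply/subsetP=> _ /imsetP[i _ ->]; apply: HG (edP i).
move=> _ _ /imsetP[i _ ->] /imsetP[j _ ->] ed_ij g gG /meetsP[x xg /ed_block xi].
apply/negP=> /meetsP[y yg /ed_block yj].
(* An edge [g] inside some [H k] has all its endpoints there, which forces both [i] and [j] to equal
   [k]. *)
suff ij : i = j by rewrite ij eqxx in ed_ij.
move: gG; rewrite EG inE => /orP[/bigcupP[k _ /edge_subset/subsetP gk]|].
  by rewrite (H_block i k x xi (gk _ xg)) -(H_block j k y yj (gk _ yg)).
(* A connecting edge has [vs k] as its only endpoint in any of the [H l], so [x] and [y] are the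
   same vertex and their blocks agree. *)
case/imsetP=> k _ gE; have g_vs l z : z \in g -> z \in vertices (H l) -> z = vs k.
  by rewrite gE !inE => /orP[]/eqP-> //; rewrite (negPf (v_new l)).
by apply: (H_block i j x); rewrite // (g_vs i x xg xi) -(g_vs j y yg yj).
Qed.
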